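(* Let $\mathfrak{g}$ be a finite dimensional Lie algebra over $k$. A quasi-Frobenius Lie object in $\mathbf{Rep}(\mathfrak{g})$ is a $\mathfrak{g}$-quasi-Frobenius Lie algebra. That is, if $((\mathfrak{q},\rho),b,\overline{\beta})$ is a quasi-Frobenius Lie object in $\mathbf{Rep}(\mathfrak{g})$, then, with the bracket $[u,v]:=b(u\otimes v)$ and the form $\beta(u,v):=\overline{\beta}(u)(v)$ for $u,v\in\mathfrak{q}$, the triple $(\mathfrak{q},\beta,\rho)$ is a $\mathfrak{g}$-quasi-Frobenius Lie algebra.
   Context: $k$ is a field of characteristic zero. A quasi-Frobenius Lie algebra over $k$ is a pair $(\mathfrak{q},\beta)$ with $\mathfrak{q}$ a Lie algebra over $k$ and $\beta$ a nondegenerate skew-symmetric bilinear form on $\mathfrak{q}$ with $\beta([u,v],w)+\beta([v,w],u)+\beta([w,u],v)=0$ for all $u,v,w\in\mathfrak{q}$. A $\mathfrak{g}$-quasi-Frobenius Lie algebra is a triple $(\mathfrak{q},\beta,\rho)$ with $(\mathfrak{q},\beta)$ quasi-Frobenius and $\rho:\mathfrak{g}\to\mathfrak{gl}(\mathfrak{q})$, $x\mapsto\rho_x$, a representation such that each $\rho_x$ is a derivation of $\mathfrak{q}$ and $\beta(\rho_x(u),v)+\beta(u,\rho_x(v))=0$ for all $x\in\mathfrak{g}$, $u,v\in\mathfrak{q}$. Let $(\mathcal{C},\otimes,I,\Phi,l,r,c)$ be an additive symmetric monoidal category with unit $I$, associator $\Phi_{U,V,W}:(U\otimes V)\otimes W\to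 U\otimes(V\otimes W)$, left/right unit maps $l,r$ and braiding $c$. A Lie object in $\mathcal{C}$ is a pair $(L,b)$ with $b:L\otimes L\to L$ a morphism such that (i) $b+b\circ c_{L,L}=0$ and (ii) $b\circ(id_L\otimes b)\circ(id_{L\otimes(L\otimes L)}+c_{L\otimes L,L}\circ\Phi^{-1}_{L,L,L}+\Phi_{L,L,L}\circ c_{L,L\otimes L})=0$. A quasi-Frobenius Lie object in $\mathcal{C}$ is a triple $(L,b,\overline{\beta})$ such that (1) $(L,b)$ is a Lie object; (2) $L$ has a left dual $L^\ast$, with evaluation $\varepsilon:L^\ast\otimes L\to I$ and coevaluation $\eta:I\to L\otimes L^\ast$; (3) $\overline{\beta}:L\to L^\ast$ is an isomorphism such that $\beta:=\varepsilon\circ(\overline{\beta}\otimes id_L):L\otimes L\to I$ satisfies $\beta+\beta\circ c_{L,L}=0$ and $\beta\circ(b\otimes id_L)\circ[id_{(L\otimes L)\otimes L}+\Phi^{-1}_{L,L,L}\circ c_{L\otimes L,L}+c_{L,L\otimes L}\circ\Phi_{L,L,L}]=0$. $\mathbf{Rep}(\mathfrak{g})$ is the category of finite dimensional left $\mathfrak{g}$-modules over $k$ with $\mathfrak{g}$-linear maps, viewed as an additive symmetric monoidal category with the usual tensor product of $\mathfrak{g}$-modules, unit object $k$ with trivial action, the trivial associator and unit maps, and braiding $v\otimes w\mapsto w\otimes v$. The left dual of $(V,\rho)$ is $(V^\ast,\rho^\ast)$ with $\rho^\ast_x:=-\rho_x^t$, evaluation $\varepsilon(\xi\otimes v)=\xi(v)$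 and coevaluation $1\mapsto\sum_i e_i\otimes\delta^i$ for a basis $e_i$ of $V$ with dual basis $\delta^i$. *)

(* Defs.v *)
From HB Require Import structures.
From mathcomp Require Import all_boot all_order all_algebra.
From mathcomp Require Import boolp.

Set Implicit Arguments.
Unset Strict Implicit.
Unset Printing Implicit Defensive.

Import GRing.Theory.
Local Open Scope ring_scope.

Record is_lie_bracket (k : fieldType) (L : lmodType k) (br : L -> L -> L) :
    Prop := IsLieBracket {
  lie_linearl : forall v, linear (br^~ v);
  lie_linearr : forall u, linear (br u);
  lie_alt : forall u, br u u = 0;
  lie_jacobi : forall u v w,
    br u (br v w) + br v (br w u) + br w (br u v) = 0 }.

HB.mixin Record Lmodule_isLie (k : fieldType) L of GRing.Lmodule k L := {
  bracket : L -> L -> L;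
  bracketP : is_lie_bracket bracket }.

#[short(type="lieAlgType")]
HB.structure Definition LieAlgebra (k : fieldType) :=
  {L of GRing.Lmodule k L & Lmodule_isLie k L}.

#[short(type="finLieAlgType")]
HB.structure Definition FinLieAlgebra (k : fieldType) :=
  {L of Vector k L & Lmodule_isLie k L}.

Record is_representation (k : fieldType) (g : lieAlgType k) (V : lmodType k)
    (rho : g -> V -> V) : Prop := IsRepresentation {
  rho_linearl : forall u, linear (rho^~ u);
  rho_linearr : forall x, linear (rho x);
  rho_bracket : forall x y u,
    rho (bracket x y) u = rho x (rho y u) - rho y (rho x u) }.

Record is_quasi_frobenius (k : fieldType) (q : lmodType k)
    (br : q -> q -> q) (beta : q -> q -> k) : Prop := IsQuasiFrobenius {
  qf_lie : is_lie_bracket br;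
  qf_linearl : forall v, scalar (beta^~ v);
  qf_linearr : forall u, scalar (beta u);
  qf_skew : forall u v, beta u v = - beta v u;
  qf_nondegl : forall u, (forall v, beta u v = 0) -> u = 0;
  qf_nondegr : forall v, (forall u, beta u v = 0) -> v = 0;
  qf_cocycle : forall u v w,
    beta (br u v) w + beta (br v w) u + beta (br w u) v = 0 }.

Record is_g_quasi_frobenius (k : fieldType) (g : lieAlgType k)
    (q : lmodType k) (br : q -> q -> q) (beta : q -> q -> k)
    (rho : g -> q -> q) : Prop := IsGQuasiFrobenius {
  gqf_qf : is_quasi_frobenius br beta;
  gqf_rep : is_representation rho;
  gqf_derivation : forall x u v,
    rho x (br u v) = br (rho x u) v + br u (rho x v);
  gqf_invariant : forall x u v,
    beta (rho x u) v + beta u (rho x v) = 0 }.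

Record additive_category := AdditiveCategory {
  obj :> Type;
  mor : obj -> obj -> zmodType;
  idm : forall A, mor A A;
  compm : forall A B C, mor B C -> mor A B -> mor A C;
  compmA : forall A B C D (h : mor C D) (g : mor B C) (f : mor A B),
    compm h (compm g f) = compm (compm h g) f;
  comp1m : forall A B (f : mor A B), compm (idm B) f = f;
  compm1 : forall A B (f : mor A B), compm f (idm A) = f;
  compmDl : forall A B C (g g' : mor B C) (f : mor A B),
    compm (g + g') f = compm g f + compm g' f;
  compmDr : forall A B C (g : mor B C) (f f' : mor A B),
    compm g (f + f') = compm g f + compm g f';
  zero_obj : obj;
  (* In a preadditive category this says that zero_obj is a zero object. *)
  zero_objP : idm zero_obj = 0;
  biprod : obj -> obj -> obj;
  inm1 : forall A B, mor A (biprod A B);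
  inm2 : forall A B, mor B (biprod A B);
  prm1 : forall A B, mor (biprod A B) A;
  prm2 : forall A B, mor (biprod A B) B;
  prm1_inm1 : forall A B, compm (prm1 A B) (inm1 A B) = idm A;
  prm2_inm2 : forall A B, compm (prm2 A B) (inm2 A B) = idm B;
  prm1_inm2 : forall A B, compm (prm1 A B) (inm2 A B) = 0;
  prm2_inm1 : forall A B, compm (prm2 A B) (inm1 A B) = 0;
  biprodP : forall A B,
    compm (inm1 A B) (prm1 A B) + compm (inm2 A B) (prm2 A B)
      = idm (biprod A B) }.

Arguments idm {_} A.
Arguments compm {_ A B C} g f.

Declare Scope cat_scope.
Delimit Scope cat_scope with cat.
Notation "g ∘ f" := (compm g f)
  (at level 40, left associativity) : cat_scope.
Local Open Scope cat_scope.

Reserved Notation "A ⊗ B" (at level 38, left associativity).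
Reserved Notation "f ⊗m g" (at level 38, left associativity).

Record additive_smc := AdditiveSMC {
  smc_cat :> additive_category;
  tensor : smc_cat -> smc_cat -> smc_cat
    where "A ⊗ B" := (tensor A B);
  tensorm : forall A A' B B', mor A A' -> mor B B' ->
      mor (A ⊗ B) (A' ⊗ B')
    where "f ⊗m g" := (tensorm f g);
  tensorm1 : forall A B, idm A ⊗m idm B = idm (A ⊗ B);
  tensorm_comp : forall A A' A'' B B' B''
      (f' : mor A' A'') (f : mor A A') (g' : mor B' B'') (g : mor B B'),
    (f' ∘ f) ⊗m (g' ∘ g) = (f' ⊗m g') ∘ (f ⊗m g);
  tensormDl : forall A A' B B' (f f' : mor A A') (g : mor B B'),
    (f + f') ⊗m g = f ⊗m g + f' ⊗m g;
  tensormDr : forall A A' B B' (f : mor A A') (g g' : mor B B'),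
    f ⊗m (g + g') = f ⊗m g + f ⊗m g';
  unit_obj : smc_cat;
  assoc : forall A B C, mor ((A ⊗ B) ⊗ C) (A ⊗ (B ⊗ C));
  assoc_inv : forall A B C, mor (A ⊗ (B ⊗ C)) ((A ⊗ B) ⊗ C);
  assocK : forall A B C, assoc_inv A B C ∘ assoc A B C = idm _;
  assoc_invK : forall A B C, assoc A B C ∘ assoc_inv A B C = idm _;
  assoc_nat : forall A A' B B' C C'
      (f : mor A A') (g : mor B B') (h : mor C C'),
    assoc A' B' C' ∘ ((f ⊗m g) ⊗m h) = (f ⊗m (g ⊗m h)) ∘ assoc A B C;
  lunit : forall A, mor (unit_obj ⊗ A) A;
  lunit_inv : forall A, mor A (unit_obj ⊗ A);
  lunitK : forall A, lunit_inv A ∘ lunit A = idm _;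
  lunit_invK : forall A, lunit A ∘ lunit_inv A = idm _;
  lunit_nat : forall A A' (f : mor A A'),
    lunit A' ∘ (idm unit_obj ⊗m f) = f ∘ lunit A;
  runit : forall A, mor (A ⊗ unit_obj) A;
  runit_inv : forall A, mor A (A ⊗ unit_obj);
  runitK : forall A, runit_inv A ∘ runit A = idm _;
  runit_invK : forall A, runit A ∘ runit_inv A = idm _;
  runit_nat : forall A A' (f : mor A A'),
    runit A' ∘ (f ⊗m idm unit_obj) = f ∘ runit A;
  pentagon : forall A B C D,
    assoc A B (C ⊗ D) ∘ assoc (A ⊗ B) C D
      = (idm A ⊗m assoc B C D) ∘ assoc A (B ⊗ C) D
          ∘ (assoc A B C ⊗m idm D);
  triangle : forall A B,
    (idm A ⊗m lunit B) ∘ assoc A unit_obj B = runit A ⊗m idm B;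
  braid : forall A B, mor (A ⊗ B) (B ⊗ A);
  braid_nat : forall A A' B B' (f : mor A A') (g : mor B B'),
    braid A' B' ∘ (f ⊗m g) = (g ⊗m f) ∘ braid A B;
  braidK : forall A B, braid B A ∘ braid A B = idm _;
  hexagon : forall A B C,
    assoc B C A ∘ braid A (B ⊗ C) ∘ assoc A B C
      = (idm B ⊗m braid A C) ∘ assoc B A C ∘ (braid A B ⊗m idm C) }.

Arguments tensor {_} A B.
Arguments tensorm {_ A A' B B'} f g.
Arguments unit_obj {_}.
Arguments assoc {_} A B C.
Arguments assoc_inv {_} A B C.
Arguments lunit {_} A.
Arguments lunit_inv {_} A.
Arguments runit {_} A.
Arguments runit_inv {_} A.
Arguments braid {_} A B.

Notation "A ⊗ B" := (tensor A B) : cat_scope.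
Notation "f ⊗m g" := (tensorm f g) : cat_scope.

Record left_dual (C : additive_smc) (L : C) := LeftDual {
  dual_obj :> C;
  dual_ev : mor (dual_obj ⊗ L) unit_obj;
  dual_coev : mor unit_obj (L ⊗ dual_obj);
  dual_zigzag : runit L ∘ (idm L ⊗m dual_ev) ∘ assoc L dual_obj L
    ∘ (dual_coev ⊗m idm L) ∘ lunit_inv L = idm L;
  dual_zagzig : lunit dual_obj ∘ (dual_ev ⊗m idm dual_obj)
    ∘ assoc_inv dual_obj L dual_obj ∘ (idm dual_obj ⊗m dual_coev)
    ∘ runit_inv dual_obj = idm dual_obj }.

Definition is_iso (C : additive_category) (A B : C) (f : mor A B) : Prop :=
  exists g : mor B A, g ∘ f = idm A /\ f ∘ g = idm B.

Record is_lie_object (C : additive_smc) (L : C) (b : mor (L ⊗ L) L) : Prop :=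
    IsLieObject {
  lieob_skew : b + b ∘ braid L L = 0;
  lieob_jacobi : b ∘ (idm L ⊗m b) ∘
    (idm (L ⊗ (L ⊗ L)) + braid (L ⊗ L) L ∘ assoc_inv L L L
       + assoc L L L ∘ braid L (L ⊗ L)) = 0 }.

Definition form_of (C : additive_smc) (L : C) (D : left_dual L)
    (bbar : mor L D) : mor (L ⊗ L) unit_obj :=
  dual_ev D ∘ (bbar ⊗m idm L).

(* The left dual and its evaluation and coevaluation are the parameter [D]. *)
Record is_qf_lie_object (C : additive_smc) (L : C) (D : left_dual L)
    (b : mor (L ⊗ L) L) (bbar : mor L D) : Prop := IsQFLieObject {
  qfob_lie : is_lie_object b;
  qfob_iso : is_iso bbar;
  qfob_skew : form_of bbar + form_of bbar ∘ braid L L = 0;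
  qfob_cocycle : form_of bbar ∘ (b ⊗m idm L) ∘
    (idm ((L ⊗ L) ⊗ L) + assoc_inv L L L ∘ braid (L ⊗ L) L
       + braid L (L ⊗ L) ∘ assoc L L L) = 0 }.

(* Tensors are coordinate matrices with respect to the bases [vbasis fullv];
   [tens_liftE] and [tens_ext] below are the universal property of [tens]. *)
Definition tens_type (k : fieldType) (V W : vectType k) : Type :=
  'M[k]_(\dim {:V}, \dim {:W}).

HB.instance Definition _ (k : fieldType) (V W : vectType k) :=
  Vector.on (tens_type V W).

Definition tens_space (k : fieldType) (V W : vectType k) : vectType k :=
  Eval cbv delta [reverse_coercion] beta in (tens_type V W : vectType k).

Section Tensor.
Variable k : fieldType.
Implicit Types U V W X Y : vectType k.

Definition tens V W (v : V) (w : W) : tens_space V W :=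
  \matrix_(i, j) (coord (vbasis {:V}) i v * coord (vbasis {:W}) j w).

Definition tens_lift_fun V W U (f : V -> W -> U) (t : tens_space V W) : U :=
  \sum_i \sum_j (t : 'M_(_, _)) i j *: f (vbasis {:V})`_i (vbasis {:W})`_j.

Fact tens_lift_linear V W U (f : V -> W -> U) : linear (tens_lift_fun f).
Proof.
move=> a s t; rewrite /tens_lift_fun scaler_sumr -big_split /=.
apply: eq_bigr => i _; rewrite scaler_sumr -big_split /=.
by apply: eq_bigr => j _; rewrite !mxE scalerDl scalerA.
Qed.

HB.instance Definition _ V W U (f : V -> W -> U) :=
  GRing.isLinear.Build k (tens_space V W) U _ (tens_lift_fun f)
    (tens_lift_linear f).

Definition tens_lift V W U (f : V -> W -> U) : 'Hom(tens_space V W, U) :=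
  linfun (tens_lift_fun f).

Fact tens_linear V W (v : V) : linear (@tens V W v).
Proof.
by move=> a w w'; apply/matrixP=> i j; rewrite !mxE linearP mulrDr mulrCA.
Qed.

HB.instance Definition _ V W (v : V) :=
  GRing.isLinear.Build k W (tens_space V W) _ (@tens V W v)
    (@tens_linear V W v).

Lemma tens_linearl V W (w : W) : linear ((@tens V W)^~ w).
Proof.
by move=> a v v'; apply/matrixP=> i j; rewrite !mxE linearP mulrDl mulrA.
Qed.

Lemma tensDl V W (v v' : V) (w : W) : tens (v + v') w = tens v w + tens v' w.
Proof. by have := tens_linearl w 1 v v'; rewrite !scale1r. Qed.

Lemma tens0l V W (w : W) : tens (0 : V) w = 0.
Proof. by apply: (addrI (tens 0 w)); rewrite -tensDl !addr0. Qed.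

Lemma tensZl V W a (v : V) (w : W) : tens (a *: v) w = a *: tens v w.
Proof. by have := tens_linearl w a v 0; rewrite tens0l !addr0. Qed.

Lemma tens_suml V W n (F : 'I_n -> V) (w : W) :
  tens (\sum_i F i) w = \sum_i tens (F i) w.
Proof.
elim/big_rec2: _ => [|i t v _ <-]; first exact: tens0l.
exact: tensDl.
Qed.

Lemma linear_comb V U (f : V -> U) n (a : 'I_n -> k) (e : 'I_n -> V) :
  linear f -> f (\sum_i a i *: e i) = \sum_i a i *: f (e i).
Proof.
move=> fP; have f0 : f 0 = 0.
  by have := fP (-1) 0 0; rewrite scaler0 addr0 scaleN1r addNr.
have fD u v : f (u + v) = f u + f v by have := fP 1 u v; rewrite !scale1r.
rewrite (big_morph f fD f0); apply: eq_bigr => i _.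
by have := fP (a i) (e i) 0; rewrite f0 !addr0.
Qed.

Lemma tens_liftE V W U (f : V -> W -> U) (v : V) (w : W) :
    (forall w, linear (f^~ w)) -> (forall v, linear (f v)) ->
  tens_lift f (tens v w) = f v w.
Proof.
move=> fl fr; rewrite lfunE /= /tens_lift_fun.
rewrite {2}(coord_vbasis (memvf v)) {2}(coord_vbasis (memvf w)).
rewrite (linear_comb _ _ (fl _)); apply: eq_bigr => i _.
rewrite (linear_comb _ _ (fr _)) scaler_sumr; apply: eq_bigr => j _.
by rewrite mxE scalerA.
Qed.

Lemma tens_decomp V W (t : tens_space V W) :
  t = \sum_i \sum_j (t : 'M_(_, _)) i j *:
        tens (vbasis {:V})`_i (vbasis {:W})`_j.
Proof.
rewrite [LHS](matrix_sum_delta (t : 'M_(_, _))).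
apply: eq_bigr => i _; apply: eq_bigr => j _; congr (_ *: _).
apply/matrixP=> i' j'; rewrite !mxE.
rewrite !(coord_free _ _ (basis_free (vbasisP _))) -natrM mulnb.
by rewrite (eq_sym i') (eq_sym j').
Qed.

Lemma tens_ind V W (P : tens_space V W -> Prop) :
  P 0 -> (forall s t, P s -> P t -> P (s + t)) ->
  (forall v w, P (tens v w)) -> forall t, P t.
Proof.
move=> P0 PD Pt t; rewrite [t]tens_decomp.
apply: (big_ind P) => // i _; apply: (big_ind P) => // j _.
by rewrite -linearZ; apply: Pt.
Qed.

Lemma tens_ext V W U (f h : 'Hom(tens_space V W, U)) :
  (forall v w, f (tens v w) = h (tens v w)) -> f = h.
Proof.
move=> fh; apply/lfunP; apply: tens_ind => //; first by rewrite !linear0.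
by move=> s t Hs Ht; rewrite !linearD /= Hs Ht.
Qed.

Lemma tens_ext3l V W U X
    (f h : 'Hom(tens_space (tens_space V W) U, X)) :
  (forall v w u, f (tens (tens v w) u) = h (tens (tens v w) u)) -> f = h.
Proof.
move=> fh; apply: tens_ext => t u; elim/tens_ind: t => [|s t Hs Ht|v w] //.
  by rewrite tens0l !linear0.
by rewrite tensDl !linearD /= Hs Ht.
Qed.

Lemma tens_ext3r V W U X
    (f h : 'Hom(tens_space V (tens_space W U), X)) :
  (forall v w u, f (tens v (tens w u)) = h (tens v (tens w u))) -> f = h.
Proof.
move=> fh; apply: tens_ext => v t; elim/tens_ind: t => [|s t Hs Ht|w u] //.
  by rewrite !linear0.
by rewrite !linearD /= Hs Ht.
Qed.

Lemma tens_ext4 V W U X Y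
    (f h : 'Hom(tens_space (tens_space (tens_space V W) U) X, Y)) :
    (forall v w u x,
      f (tens (tens (tens v w) u) x) = h (tens (tens (tens v w) u) x)) ->
  f = h.
Proof.
move=> fh; apply: tens_ext3l => t u x.
elim/tens_ind: t => [|s t Hs Ht|v w] //.
  by rewrite !tens0l !linear0.
by rewrite !tensDl !linearD /= Hs Ht.
Qed.

Definition tens_map V V' W W' (f : 'Hom(V, V')) (g : 'Hom(W, W')) :
    'Hom(tens_space V W, tens_space V' W') :=
  tens_lift (fun v w => tens (f v) (g w)).

Lemma tens_mapE V V' W W' (f : 'Hom(V, V')) (g : 'Hom(W, W')) v w :
  tens_map f g (tens v w) = tens (f v) (g w).
Proof.
apply: tens_liftE => [w' a u u'|v' a u u']; last by rewrite !linearP.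
by rewrite linearP tens_linearl.
Qed.

Definition tens_swap V W : 'Hom(tens_space V W, tens_space W V) :=
  tens_lift (fun v w => tens w v).

Lemma tens_swapE V W (v : V) (w : W) : tens_swap V W (tens v w) = tens w v.
Proof.
by apply: tens_liftE => [w' a u u'|v' a u u']; rewrite ?linearP ?tens_linearl.
Qed.

Definition tens_assoc V W U :
    'Hom(tens_space (tens_space V W) U, tens_space V (tens_space W U)) :=
  tens_lift (fun t u => tens_lift (fun v w => tens v (tens w u)) t).

Lemma tens_assocE V W U (v : V) (w : W) (u : U) :
  tens_assoc V W U (tens (tens v w) u) = tens v (tens w u).
Proof.
have E (u' : U) v' w' :
    tens_lift (fun (v : V) (w : W) => tens v (tens w u')) (tens v' w')
      = tens v' (tens w' u').
  by apply: tens_liftE => [y a x x'|x a y y'];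
     rewrite ?tens_linearl ?linearP.
rewrite /tens_assoc tens_liftE ?E // => [u' a t t'|t a x x'].
  by rewrite linearP.
elim/tens_ind: t => [|s t Hs Ht|v' w'].
- by rewrite !linear0 addr0.
- by rewrite !linearD /= Hs Ht addrACA.
- by rewrite !E !linearP.
Qed.

Definition tens_assoc_inv V W U :
    'Hom(tens_space V (tens_space W U), tens_space (tens_space V W) U) :=
  tens_lift (fun v t => tens_lift (fun w u => tens (tens v w) u) t).

Lemma tens_assoc_invE V W U (v : V) (w : W) (u : U) :
  tens_assoc_inv V W U (tens v (tens w u)) = tens (tens v w) u.
Proof.
have E (v' : V) w' u' :
    tens_lift (fun (w : W) (u : U) => tens (tens v' w) u) (tens w' u')
      = tens (tens v' w') u'.
  by apply: tens_liftE => [y a x x'|x a y y'];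
     rewrite ?linearP ?tens_linearl.
rewrite /tens_assoc_inv tens_liftE ?E // => [t a x x'|v' a t t'].
  elim/tens_ind: t => [|s t Hs Ht|w' u'].
- by rewrite !linear0 addr0.
  - by rewrite !linearD /= Hs Ht addrACA.
  - by rewrite !E !tens_linearl.
by rewrite linearP.
Qed.

Definition tens_lunit V : 'Hom(tens_space k^o V, V) :=
  tens_lift (fun (a : k^o) (v : V) => a *: v).

Lemma tens_lunitE V (a : k^o) (v : V) : tens_lunit V (tens a v) = a *: v.
Proof.
apply: tens_liftE => [w b u u'|b c u u']; first by rewrite scalerDl scalerA.
by rewrite scalerDr !scalerA mulrC.
Qed.

Definition tens_lunit_inv V : 'Hom(V, tens_space k^o V) :=
  linfun (tens (1 : k^o)).

Definition tens_runit V : 'Hom(tens_space V k^o, V) :=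
  tens_lift (fun (v : V) (a : k^o) => a *: v).

Lemma tens_runitE V (v : V) (a : k^o) : tens_runit V (tens v a) = a *: v.
Proof.
apply: tens_liftE => [b c u u'|w b u u']; last by rewrite scalerDl scalerA.
by rewrite scalerDr !scalerA mulrC.
Qed.

Definition tens_runit_inv V : 'Hom(V, tens_space V k^o) :=
  (tens_swap k^o V \o tens_lunit_inv V)%VF.

Lemma tens_lunit_invE V (v : V) : tens_lunit_inv V v = tens (1 : k^o) v.
Proof. by rewrite lfunE. Qed.

Lemma tens_runit_invE V (v : V) : tens_runit_inv V v = tens v (1 : k^o).
Proof. by rewrite lfunE /= tens_lunit_invE tens_swapE. Qed.

End Tensor.

Section Rep.
Variables (k : fieldType) (g : lieAlgType k).

Record rep := MkRep {
  rep_space :> vectType k;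
  rep_act : g -> rep_space -> rep_space;
  rep_actP : is_representation rep_act }.

HB.instance Definition _ (V : rep) (x : g) :=
  GRing.isLinear.Build k V V _ (@rep_act V x) (rho_linearr (rep_actP V) x).

Definition rep_endo (V : rep) (x : g) : 'End(V) := linfun (@rep_act V x).

Lemma rep_endoE (V : rep) x (u : V) : rep_endo V x u = rep_act x u.
Proof. exact: lfunE. Qed.

(* Boolean, so that equivariant maps form a subtype of ['Hom(V, W)] on which
   equality is equality of linear maps. *)
Definition equivariant (V W : rep) : pred 'Hom(V, W) :=
  fun f => `[< forall x u, f (rep_act x u) = rep_act x (f u) >].

Record rep_hom (V W : rep) := RepHom {
  rep_fun :> 'Hom(V, W);
  rep_funP : rep_fun \in @equivariant V W }.

HB.instance Definition _ (V W : rep) := [isSub for @rep_fun V W].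
HB.instance Definition _ (V W : rep) := [Choice of rep_hom V W by <:].

Fact equivariant_zmod_closed (V W : rep) : zmod_closed (@equivariant V W).
Proof.
split=> [|f h]; first by apply/asboolP=> x u; rewrite !zero_lfunE linear0.
move=> /asboolP fP /asboolP hP; apply/asboolP=> x u.
by rewrite !add_lfunE !opp_lfunE fP hP linearB.
Qed.

HB.instance Definition _ (V W : rep) :=
  GRing.isZmodClosed.Build _ (@equivariant V W)
    (@equivariant_zmod_closed V W).
HB.instance Definition _ (V W : rep) :=
  [SubChoice_isSubZmodule of rep_hom V W by <:].

Lemma rep_homP (V W : rep) (f h : rep_hom V W) :
  rep_fun f = rep_fun h -> f = h.
Proof. exact: val_inj. Qed.

Lemma rep_hom_act (V W : rep) (f : rep_hom V W) x u :
  f (rep_act x u) = rep_act x (f u).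
Proof. by have /asboolP := rep_funP f; apply. Qed.

Definition mk_rep_hom (V W : rep) (f : 'Hom(V, W))
    (fP : forall x u, f (rep_act x u) = rep_act x (f u)) : rep_hom V W :=
  RepHom (asboolT fP : f \in @equivariant V W).

Fact rep_id_subproof (V : rep) x (u : V) :
  (\1%VF : 'End(V)) (rep_act x u) = rep_act x ((\1%VF : 'End(V)) u).
Proof. by rewrite !id_lfunE. Qed.

Definition rep_id (V : rep) : rep_hom V V := mk_rep_hom (@rep_id_subproof V).

Fact rep_comp_subproof (U V W : rep) (h : rep_hom V W) (f : rep_hom U V) x u :
  (h \o f)%VF (rep_act x u) = rep_act x ((h \o f)%VF u).
Proof. by rewrite !comp_lfunE !rep_hom_act. Qed.

Definition rep_comp (U V W : rep) (h : rep_hom V W) (f : rep_hom U V) :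
  rep_hom U W := mk_rep_hom (rep_comp_subproof h f).

Section ZeroAction.
Variable V : vectType k.

Definition zero_act (x : g) (u : V) : V := 0.

Fact zero_act_subproof : is_representation zero_act.
Proof.
by split=> [u a x y|x a u v|x y u];
   rewrite /zero_act ?scaler0 ?addr0 ?subr0.
Qed.

Definition rep_trivial : rep := MkRep zero_act_subproof.
End ZeroAction.

Definition rep_zero : rep := rep_trivial 'rV[k]_0.
Definition rep_unit : rep := rep_trivial k^o.

Section Sum.
Variables V W : rep.

Definition sum_act (x : g) (u : V * W) : V * W :=
  (rep_act x u.1, rep_act x u.2).

Fact sum_act_subproof : is_representation sum_act.
Proof.
split=> [u a x y|x a u v|x y u]; rewrite /sum_act.
- by rewrite !(rho_linearl (rep_actP _)).
- by rewrite /= !linearP.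
- by rewrite !(rho_bracket (rep_actP _)).
Qed.

Definition rep_sum : rep := MkRep sum_act_subproof.

Definition sum_in1_fun (v : V) : rep_sum := (v, 0).
Definition sum_in2_fun (w : W) : rep_sum := (0, w).
Fact sum_in1_linear : linear sum_in1_fun.
Proof. by move=> a u v; congr pair; rewrite /= scaler0 addr0. Qed.
Fact sum_in2_linear : linear sum_in2_fun.
Proof. by move=> a u v; congr pair; rewrite /= scaler0 addr0. Qed.
HB.instance Definition _ :=
  GRing.isLinear.Build k V rep_sum _ sum_in1_fun sum_in1_linear.
HB.instance Definition _ :=
  GRing.isLinear.Build k W rep_sum _ sum_in2_fun sum_in2_linear.

Definition sum_in1 : 'Hom(V, rep_sum) := linfun sum_in1_fun.
Definition sum_in2 : 'Hom(W, rep_sum) := linfun sum_in2_fun.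
Definition sum_pr1 : 'Hom(rep_sum, V) := linfun (fst : V * W -> V).
Definition sum_pr2 : 'Hom(rep_sum, W) := linfun (snd : V * W -> W).

Fact sum_in1_subproof x u : sum_in1 (rep_act x u) = rep_act x (sum_in1 u).
Proof. by rewrite !lfunE; congr pair; rewrite linear0. Qed.
Fact sum_in2_subproof x u : sum_in2 (rep_act x u) = rep_act x (sum_in2 u).
Proof. by rewrite !lfunE; congr pair; rewrite linear0. Qed.
Fact sum_pr1_subproof x u : sum_pr1 (rep_act x u) = rep_act x (sum_pr1 u).
Proof. by rewrite !lfunE. Qed.
Fact sum_pr2_subproof x u : sum_pr2 (rep_act x u) = rep_act x (sum_pr2 u).
Proof. by rewrite !lfunE. Qed.

Definition rep_in1 := mk_rep_hom sum_in1_subproof.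
Definition rep_in2 := mk_rep_hom sum_in2_subproof.
Definition rep_pr1 := mk_rep_hom sum_pr1_subproof.
Definition rep_pr2 := mk_rep_hom sum_pr2_subproof.
End Sum.

Lemma rep_add_val (V W : rep) (f h : rep_hom V W) :
  rep_fun (f + h) = rep_fun f + rep_fun h.
Proof. by []. Qed.

Local Obligation Tactic := idtac.

Program Definition Rep_additive : additive_category :=
  @AdditiveCategory rep (fun V W => rep_hom V W) rep_id rep_comp
    _ _ _ _ _ rep_zero _ rep_sum rep_in1 rep_in2 rep_pr1 rep_pr2
    _ _ _ _ _.
Next Obligation. by move=> *; apply/rep_homP; apply: comp_lfunA. Qed.
Next Obligation. by move=> *; apply/rep_homP; apply: comp_lfun1l. Qed.
Next Obligation. by move=> *; apply/rep_homP; apply: comp_lfun1r. Qed.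
Next Obligation. by move=> *; apply/rep_homP; apply: comp_lfunDl. Qed.
Next Obligation. by move=> *; apply/rep_homP; apply: comp_lfunDr. Qed.
Next Obligation.
apply/rep_homP/lfunP=> u; rewrite id_lfunE zero_lfunE.
by apply/rowP; case.
Qed.
Next Obligation.
by move=> A B; apply/rep_homP/lfunP=> u; rewrite comp_lfunE id_lfunE !lfunE.
Qed.
Next Obligation.
by move=> A B; apply/rep_homP/lfunP=> u; rewrite comp_lfunE id_lfunE !lfunE.
Qed.
Next Obligation.
by move=> A B; apply/rep_homP/lfunP=> u; rewrite comp_lfunE zero_lfunE !lfunE.
Qed.
Next Obligation.
by move=> A B; apply/rep_homP/lfunP=> u; rewrite comp_lfunE zero_lfunE !lfunE.
Qed.
Next Obligation.
move=> A B; apply/rep_homP/lfunP=> u.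
rewrite rep_add_val add_lfunE !comp_lfunE id_lfunE !lfunE.
by case: u => u v; congr pair; rewrite ?addr0 ?add0r.
Qed.

Section TensorRep.
Variables V W : rep.

Definition tens_endo (x : g) : 'End(tens_space V W) :=
  tens_map (rep_endo V x) \1%VF + tens_map \1%VF (rep_endo W x).

Lemma tens_endoE x (v : V) (w : W) :
  tens_endo x (tens v w) = tens (rep_act x v) w + tens v (rep_act x w).
Proof. by rewrite add_lfunE !tens_mapE !id_lfunE !rep_endoE. Qed.

Lemma tens_endo_linear : linear tens_endo.
Proof.
move=> a x y; apply: tens_ext => v w.
rewrite tens_endoE add_lfunE scale_lfunE !tens_endoE !(rho_linearl (rep_actP _)).
by rewrite tens_linearl linearP scalerDr addrACA.
Qed.

Lemma tens_endo_bracket x y :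
  tens_endo (bracket x y)
    = (tens_endo x \o tens_endo y)%VF - (tens_endo y \o tens_endo x)%VF.
Proof.
have addrE (M : zmodType) (a b c d p q : M) :
    (a - b) + (c - d) = (a + p + (q + c)) - (b + q + (p + d)).
  rewrite [q + c]addrC [p + d]addrC (addrACA a p) (addrACA b q) [q + p]addrC.
  by rewrite opprD (addrACA (a + c)) subrr addr0 opprD addrACA.
apply: tens_ext => v w.
rewrite tens_endoE add_lfunE opp_lfunE !comp_lfunE !tens_endoE !linearD /=
  !tens_endoE.
rewrite !(rho_bracket (rep_actP _)) tensDl -scaleN1r tensZl scaleN1r linearB.
by rewrite -opprD; apply: addrE.
Qed.

Fact tens_endo_subproof : is_representation (fun x t => tens_endo x t).
Proof.
split=> [t a x y|x a s t|x y t].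
- by rewrite tens_endo_linear add_lfunE scale_lfunE.
- by rewrite linearP.
- by rewrite tens_endo_bracket add_lfunE opp_lfunE !comp_lfunE.
Qed.

Definition rep_tensor : rep := MkRep tens_endo_subproof.
End TensorRep.

Lemma rep_tensorE (V W : rep) x (v : V) (w : W) :
  rep_act (r := rep_tensor V W) x (tens v w)
    = tens (rep_act x v) w + tens v (rep_act x w).
Proof. exact: tens_endoE. Qed.

Section TensorMap.
Variables (V V' W W' : rep) (f : rep_hom V V') (h : rep_hom W W').

Fact tens_map_subproof x (t : rep_tensor V W) :
  (tens_map f h : 'Hom(rep_tensor V W, rep_tensor V' W')) (rep_act x t)
    = rep_act x (tens_map f h t : rep_tensor V' W').
Proof.
rewrite /= -!comp_lfunE; move: t; apply/lfunP/tens_ext => v w.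
rewrite !comp_lfunE tens_endoE linearD /= !tens_mapE tens_endoE.
by rewrite !rep_hom_act.
Qed.

Definition rep_tensorm : rep_hom (rep_tensor V W) (rep_tensor V' W') :=
  mk_rep_hom tens_map_subproof.
End TensorMap.

Fact tens_swap_subproof (V W : rep) x (t : rep_tensor V W) :
  (tens_swap V W : 'Hom(rep_tensor V W, rep_tensor W V)) (rep_act x t)
    = rep_act x (tens_swap V W t : rep_tensor W V).
Proof.
rewrite /= -!comp_lfunE; move: t; apply/lfunP/tens_ext => v w.
by rewrite !comp_lfunE tens_endoE linearD /= !tens_swapE tens_endoE addrC.
Qed.

Definition rep_braid V W := mk_rep_hom (@tens_swap_subproof V W).

Fact tens_assoc_subproof (V W U : rep) x
    (t : rep_tensor (rep_tensor V W) U) :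
  (tens_assoc V W U
    : 'Hom(rep_tensor (rep_tensor V W) U, rep_tensor V (rep_tensor W U)))
    (rep_act x t)
  = rep_act x (tens_assoc V W U t : rep_tensor V (rep_tensor W U)).
Proof.
rewrite /= -!comp_lfunE; move: t; apply/lfunP/tens_ext3l => v w u.
rewrite !comp_lfunE tens_assocE (@tens_endoE (rep_tensor V W) U)
  (@tens_endoE V (rep_tensor W U)) !rep_tensorE.
by rewrite !(tensDl, linearD) /= !tens_assocE addrA.
Qed.

Definition rep_assoc V W U := mk_rep_hom (@tens_assoc_subproof V W U).

Fact tens_assoc_inv_subproof (V W U : rep) x
    (t : rep_tensor V (rep_tensor W U)) :
  (tens_assoc_inv V W U
    : 'Hom(rep_tensor V (rep_tensor W U), rep_tensor (rep_tensor V W) U))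
    (rep_act x t)
  = rep_act x (tens_assoc_inv V W U t : rep_tensor (rep_tensor V W) U).
Proof.
rewrite /= -!comp_lfunE; move: t; apply/lfunP/tens_ext3r => v w u.
rewrite !comp_lfunE tens_assoc_invE (@tens_endoE (rep_tensor V W) U)
  (@tens_endoE V (rep_tensor W U)) !rep_tensorE.
by rewrite !(tensDl, linearD) /= !tens_assoc_invE addrA.
Qed.

Definition rep_assoc_inv V W U := mk_rep_hom (@tens_assoc_inv_subproof V W U).

Fact tens_lunit_subproof (V : rep) x (t : rep_tensor rep_unit V) :
  (tens_lunit V : 'Hom(rep_tensor rep_unit V, V)) (rep_act x t)
    = rep_act x (tens_lunit V t).
Proof.
rewrite /= -(rep_endoE x) -!comp_lfunE; move: t; apply/lfunP/tens_ext => a v.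
rewrite !comp_lfunE tens_endoE linearD /= !tens_lunitE rep_endoE linearZ /=.
by rewrite scale0r add0r.
Qed.

Definition rep_lunit V := mk_rep_hom (@tens_lunit_subproof V).

Fact tens_lunit_inv_subproof (V : rep) x (v : V) :
  (tens_lunit_inv V : 'Hom(V, rep_tensor rep_unit V)) (rep_act x v)
    = rep_act x (tens_lunit_inv V v : rep_tensor rep_unit V).
Proof. by rewrite !tens_lunit_invE rep_tensorE tens0l add0r. Qed.

Definition rep_lunit_inv V := mk_rep_hom (@tens_lunit_inv_subproof V).

Fact tens_runit_subproof (V : rep) x (t : rep_tensor V rep_unit) :
  (tens_runit V : 'Hom(rep_tensor V rep_unit, V)) (rep_act x t)
    = rep_act x (tens_runit V t).
Proof.
rewrite /= -(rep_endoE x) -!comp_lfunE; move: t; apply/lfunP/tens_ext => v a.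
rewrite !comp_lfunE tens_endoE linearD /= !tens_runitE rep_endoE linearZ /=.
by rewrite scale0r addr0.
Qed.

Definition rep_runit V := mk_rep_hom (@tens_runit_subproof V).

Fact tens_runit_inv_subproof (V : rep) x (v : V) :
  (tens_runit_inv V : 'Hom(V, rep_tensor V rep_unit)) (rep_act x v)
    = rep_act x (tens_runit_inv V v : rep_tensor V rep_unit).
Proof. by rewrite !tens_runit_invE rep_tensorE linear0 addr0. Qed.

Definition rep_runit_inv V := mk_rep_hom (@tens_runit_inv_subproof V).

Program Definition Rep : additive_smc :=
  @AdditiveSMC Rep_additive rep_tensor rep_tensorm
    _ _ _ _ rep_unit rep_assoc rep_assoc_inv _ _ _
    rep_lunit rep_lunit_inv _ _ _ rep_runit rep_runit_inv _ _ _ _ _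
    rep_braid _ _ _.
Next Obligation.
move=> V W; apply/rep_homP/tens_ext => v w.
by rewrite tens_mapE !id_lfunE.
Qed.
Next Obligation.
move=> A A' A'' B B' B'' f' f h' h; apply/rep_homP/tens_ext => v w.
by rewrite comp_lfunE !tens_mapE !comp_lfunE.
Qed.
Next Obligation.
move=> A A' B B' f f' h; apply/rep_homP/tens_ext => v w.
by rewrite rep_add_val add_lfunE !tens_mapE add_lfunE tensDl.
Qed.
Next Obligation.
move=> A A' B B' f h h'; apply/rep_homP/tens_ext => v w.
by rewrite rep_add_val add_lfunE !tens_mapE add_lfunE linearD.
Qed.
Next Obligation.
move=> A B C; apply/rep_homP/tens_ext3l => a b c.
by rewrite comp_lfunE tens_assocE tens_assoc_invE id_lfunE.
Qed.
Next Obligation.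
move=> A B C; apply/rep_homP/tens_ext3r => a b c.
by rewrite comp_lfunE tens_assoc_invE tens_assocE id_lfunE.
Qed.
Next Obligation.
move=> A A' B B' C C' f h j; apply/rep_homP/tens_ext3l => a b c.
by rewrite !comp_lfunE tens_assocE !tens_mapE tens_assocE.
Qed.
Next Obligation.
move=> A; apply/rep_homP/tens_ext => a v.
rewrite comp_lfunE tens_lunitE tens_lunit_invE id_lfunE.
by rewrite linearZ /= -tensZl /GRing.scale /= mulr1.
Qed.
Next Obligation.
move=> A; apply/rep_homP/lfunP => v.
by rewrite comp_lfunE tens_lunit_invE tens_lunitE id_lfunE scale1r.
Qed.
Next Obligation.
move=> A A' f; apply/rep_homP/tens_ext => a v.
by rewrite !comp_lfunE tens_mapE !tens_lunitE id_lfunE linearZ.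
Qed.
Next Obligation.
move=> A; apply/rep_homP/tens_ext => v a.
rewrite comp_lfunE tens_runitE tens_runit_invE id_lfunE.
by rewrite tensZl -linearZ /GRing.scale /= mulr1.
Qed.
Next Obligation.
move=> A; apply/rep_homP/lfunP => v.
by rewrite comp_lfunE tens_runit_invE tens_runitE id_lfunE scale1r.
Qed.
Next Obligation.
move=> A A' f; apply/rep_homP/tens_ext => v a.
by rewrite !comp_lfunE tens_mapE !tens_runitE id_lfunE linearZ.
Qed.
Next Obligation.
move=> A B C D; apply/rep_homP/tens_ext4 => a b c d.
by rewrite !comp_lfunE !(tens_assocE, tens_mapE) !id_lfunE.
Qed.
Next Obligation.
move=> A B; apply/rep_homP/tens_ext3l => v a w.
rewrite comp_lfunE tens_assocE !tens_mapE tens_lunitE tens_runitE !id_lfunE.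
by rewrite tensZl linearZ.
Qed.
Next Obligation.
move=> A A' B B' f h; apply/rep_homP/tens_ext => v w.
by rewrite !comp_lfunE tens_mapE !tens_swapE tens_mapE.
Qed.
Next Obligation.
move=> A B; apply/rep_homP/tens_ext => v w.
by rewrite comp_lfunE !tens_swapE id_lfunE.
Qed.
Next Obligation.
move=> A B C; apply/rep_homP/tens_ext3l => a b c.
rewrite !comp_lfunE !(tens_assocE, tens_mapE) !tens_swapE !id_lfunE.
by rewrite !tens_assocE tens_mapE id_lfunE tens_swapE.
Qed.

Section Dual.
Variable V : rep.

Definition dual_act (x : g) (xi : 'Hom(V, k^o)) : 'Hom(V, k^o) :=
  - (xi \o rep_endo V x)%VF.

Lemma dual_actE x xi v : dual_act x xi v = - xi (rep_act x v).
Proof. by rewrite opp_lfunE comp_lfunE rep_endoE. Qed.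

Fact dual_act_subproof : is_representation dual_act.
Proof.
split=> [xi a x y|x a xi zeta|x y xi]; apply/lfunP => v.
- rewrite dual_actE add_lfunE scale_lfunE !dual_actE.
  by rewrite (rho_linearl (rep_actP V)) linearP opprD scalerN.
- rewrite dual_actE !add_lfunE !scale_lfunE !dual_actE.
  by rewrite opprD scalerN.
rewrite dual_actE add_lfunE [X in _ = _ + X]opp_lfunE !dual_actE (rho_bracket (rep_actP V)).
by rewrite linearB /= !opprK opprB.
Qed.

Definition rep_dual : rep := MkRep dual_act_subproof.

Definition tens_ev : 'Hom(tens_space rep_dual V, k^o) :=
  tens_lift (fun (xi : 'Hom(V, k^o)) (v : V) => xi v).

Lemma tens_evE (xi : rep_dual) (v : V) :
  tens_ev (tens xi v) = (xi : 'Hom(V, k^o)) v.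
Proof.
apply: tens_liftE => [w a x y|w a x y]; last by rewrite linearP.
by rewrite add_lfunE scale_lfunE.
Qed.

Fact tens_ev_subproof x (t : rep_tensor rep_dual V) :
  (tens_ev : 'Hom(rep_tensor rep_dual V, rep_unit)) (rep_act x t)
    = rep_act x (tens_ev t : rep_unit).
Proof.
elim/tens_ind: t => [|s t Hs Ht|xi v]; first by rewrite !linear0.
  by rewrite !linearD /= Hs Ht addr0.
by rewrite rep_tensorE linearD /= !tens_evE dual_actE addNr.
Qed.

Definition rep_ev : rep_hom (rep_tensor rep_dual V) rep_unit :=
  mk_rep_hom tens_ev_subproof.

Definition dual_basis (i : 'I_(\dim {:V})) : 'Hom(V, k^o) :=
  linfun (coord (vbasis {:V}) i : V -> k^o).

Lemma dual_basisE i v : dual_basis i v = coord (vbasis {:V}) i v.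
Proof. exact: lfunE. Qed.

Lemma dual_decomp (xi : 'Hom(V, k^o)) :
  xi = \sum_(i < \dim {:V}) xi (vbasis {:V})`_i *: dual_basis i.
Proof.
apply/lfunP=> v; rewrite {1}(coord_vbasis (memvf v)) linear_sum sum_lfunE /=.
apply: eq_bigr => i _; rewrite scale_lfunE dual_basisE linearZ /=.
exact: mulrC.
Qed.

Definition coev_elem : rep_tensor V rep_dual :=
  \sum_(i < \dim {:V}) tens (vbasis {:V})`_i (dual_basis i : rep_dual).

Lemma coev_elem_act x : rep_act x coev_elem = 0.
Proof.
rewrite /coev_elem linear_sum /=.
under eq_bigr => i _ do rewrite (@tens_endoE V rep_dual).
rewrite big_split /=.
pose c i j := coord (vbasis {:V}) j (rep_act x (vbasis {:V})`_i).
have -> : \sum_(i < \dim {:V})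
    tens (rep_act x (vbasis {:V})`_i) (dual_basis i : rep_dual) =
    \sum_(i < \dim {:V}) \sum_(j < \dim {:V})
      c i j *: tens (vbasis {:V})`_j (dual_basis i : rep_dual).
  apply: eq_bigr => i _.
  rewrite {1}(coord_vbasis (memvf (rep_act x _))) tens_suml.
  by apply: eq_bigr => j _; rewrite tensZl.
rewrite exchange_big -big_split /= big1 // => j _.
have -> : dual_act x (dual_basis j)
    = - \sum_(i < \dim {:V}) c i j *: (dual_basis i : rep_dual).
  rewrite [LHS]dual_decomp -sumrN; apply: eq_bigr => i _.
  by rewrite dual_actE dual_basisE scaleNr.
rewrite linearN linear_sum /=; apply/eqP; rewrite subr_eq0; apply/eqP.
by apply: eq_bigr => i _; rewrite linearZ.
Qed.

Definition coev_fun (a : k^o) : rep_tensor V rep_dual := a *: coev_elem.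

Fact coev_fun_linear : linear coev_fun.
Proof. by move=> a b c; rewrite /coev_fun scalerDl scalerA. Qed.

HB.instance Definition _ :=
  GRing.isLinear.Build k k^o (rep_tensor V rep_dual) _ coev_fun
    coev_fun_linear.

Definition tens_coev : 'Hom(rep_unit, rep_tensor V rep_dual) :=
  linfun coev_fun.

Lemma tens_coevE (a : rep_unit) : tens_coev a = (a : k) *: coev_elem.
Proof. exact: lfunE. Qed.

Fact tens_coev_subproof x (a : rep_unit) :
  tens_coev (rep_act x a) = rep_act x (tens_coev a).
Proof.
rewrite !tens_coevE linearZ /=; have /= -> := coev_elem_act x.
by rewrite scale0r scaler0.
Qed.

Definition rep_coev : rep_hom rep_unit (rep_tensor V rep_dual) :=
  mk_rep_hom tens_coev_subproof.

Fact rep_dual_zigzag :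
  (runit (V : Rep) ∘ (idm (V : Rep) ⊗m (rep_ev : mor (_ : Rep) unit_obj))
    ∘ assoc (V : Rep) rep_dual V
    ∘ ((rep_coev : mor (unit_obj : Rep) _) ⊗m idm (V : Rep))
    ∘ lunit_inv (V : Rep))%cat = idm (V : Rep).
Proof.
apply/rep_homP/lfunP=> v.
rewrite !comp_lfunE tens_lunit_invE tens_mapE !id_lfunE tens_coevE scale1r.
rewrite tens_suml [v in RHS](coord_vbasis (memvf v)) !linear_sum /=.
apply: eq_bigr => i _.
rewrite tens_assocE tens_mapE tens_evE dual_basisE tens_runitE id_lfunE.
by [].
Qed.

Fact rep_dual_zagzig :
  (lunit (rep_dual : Rep)
    ∘ ((rep_ev : mor (_ : Rep) unit_obj) ⊗m idm (rep_dual : Rep))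
    ∘ assoc_inv (rep_dual : Rep) V rep_dual
    ∘ (idm (rep_dual : Rep) ⊗m (rep_coev : mor (unit_obj : Rep) _))
    ∘ runit_inv (rep_dual : Rep))%cat = idm (rep_dual : Rep).
Proof.
apply/rep_homP/lfunP=> xi.
rewrite !comp_lfunE tens_lunit_invE tens_swapE tens_mapE !id_lfunE tens_coevE scale1r.
rewrite [RHS]dual_decomp !linear_sum /=.
apply: eq_bigr => i _.
by rewrite tens_assoc_invE tens_mapE tens_evE tens_lunitE id_lfunE.
Qed.

Definition rep_left_dual : left_dual (V : Rep) :=
  @LeftDual Rep V rep_dual rep_ev rep_coev rep_dual_zigzag rep_dual_zagzig.
End Dual.

End Rep.

(* Main.v *)
(** Evaluating the identities between morphisms of Rep(g) on pure tensors gives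
    the identities of a quasi-Frobenius Lie algebra; skew-symmetry of the
    bracket means alternation because 2 is invertible, and injectivity of
    [bbar] is nondegeneracy.  Equivariance of [b] says that g acts by
    derivations, and equivariance of [bbar] into the dual representation is the
    invariance of the form. *)

Require Import Defs.
From mathcomp Require Import all_boot all_order all_algebra.

Set Implicit Arguments.
Unset Strict Implicit.
Unset Printing Implicit Defensive.

Import GRing.Theory.
Local Open Scope ring_scope.

(** In characteristic zero the scalar 2 is nonzero, so it cancels; applied to
    [br u u + br u u = 0]. *)
Lemma pchar0_double_eq0 (k : fieldType) (V : lmodType k) (u : V) :
  [pchar k] =i pred0 -> u + u = 0 -> u = 0.
Proof.
move=> char_k /eqP; rewrite -mulr2n -scaler_nat scaler_eq0.
by rewrite (proj1 (pcharf0P k) char_k) => /eqP.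
Qed.

Section QFLieObject.
Variables (k : fieldType) (g : lieAlgType k) (q : rep g).
Variables (b : rep_hom (rep_tensor q q) q) (bbar : rep_hom q (rep_dual q)).

Let br (u v : q) : q := b (tens u v).
Let beta (u v : q) : k := (bbar u : 'Hom(q, k^o)) v.

Lemma rep_hom_eq0E (V W : rep g) (f : rep_hom V W) : f = 0 -> forall t, f t = 0.
Proof. by move=> -> t; apply: zero_lfunE. Qed.

Lemma form_of_tensE (u v : q) :
  rep_fun (@form_of (Rep g) q (rep_left_dual q) bbar) (tens u v) = beta u v.
Proof. by rewrite comp_lfunE tens_mapE id_lfunE tens_evE. Qed.

Lemma lie_object_antisym (u v : q) :
  @is_lie_object (Rep g) q b -> br u v + br v u = 0.
Proof.
case=> /rep_hom_eq0E/(_ (tens u v)) + _.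
by rewrite rep_add_val add_lfunE comp_lfunE tens_swapE.
Qed.

Lemma lie_object_jacobi (u v w : q) : @is_lie_object (Rep g) q b ->
  br u (br v w) + br v (br w u) + br w (br u v) = 0.
Proof.
case=> _ /rep_hom_eq0E/(_ (tens u (tens v w))).
rewrite !comp_lfunE !rep_add_val !add_lfunE !comp_lfunE id_lfunE.
rewrite tens_assoc_invE !tens_swapE tens_assocE !linearD /= !tens_mapE.
(* The two braided summands send [u ⊗ (v ⊗ w)] to [w ⊗ (u ⊗ v)] and [v ⊗ (w ⊗ u)], in this order;
   [addrAC] swaps them. *)
by rewrite !id_lfunE addrAC.
Qed.

Lemma tens_hom_is_lie_bracket : [pchar k] =i pred0 ->
  @is_lie_object (Rep g) q b -> is_lie_bracket br.
Proof.
move=> char_k lieb; split=> [v a u u'|u a v v'|u|u v w].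
- by rewrite /br tens_linearl linearP.
- by rewrite /br !linearP.
- exact/(pchar0_double_eq0 char_k)/lie_object_antisym.
- exact: lie_object_jacobi.
Qed.

Lemma qf_lie_object_skew (u v : q) :
  @is_qf_lie_object (Rep g) q (rep_left_dual q) b bbar ->
  beta u v = - beta v u.
Proof.
case=> _ _ /rep_hom_eq0E/(_ (tens u v)) + _.
rewrite rep_add_val add_lfunE [X in _ + X]comp_lfunE tens_swapE !form_of_tensE.
by move/eqP; rewrite addr_eq0 => /eqP.
Qed.

Lemma qf_lie_object_cocycle (u v w : q) :
  @is_qf_lie_object (Rep g) q (rep_left_dual q) b bbar ->
  beta (br u v) w + beta (br v w) u + beta (br w u) v = 0.
Proof.
case=> _ _ _ /rep_hom_eq0E/(_ (tens (tens u v) w)).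
rewrite !comp_lfunE !rep_add_val !add_lfunE !comp_lfunE id_lfunE.
rewrite tens_assocE !tens_swapE tens_assoc_invE !linearD /= !tens_mapE.
(* Here [(u ⊗ v) ⊗ w] goes to [(w ⊗ u) ⊗ v], then to [(v ⊗ w) ⊗ u]: again the last two terms are
   swapped. *)
by rewrite !id_lfunE !tens_evE addrAC.
Qed.

(** The functional [beta u] is [bbar u]; once it vanishes, the inverse [h] of [bbar] gives
    [u = h (bbar u) = h 0 = 0]. *)
Lemma qf_lie_object_nondegl (u : q) :
  @is_qf_lie_object (Rep g) q (rep_left_dual q) b bbar ->
  (forall v, beta u v = 0) -> u = 0.
Proof.
case=> _ [h [hK _]] _ _ beta0.
have bbar0 : bbar u = 0 by apply/lfunP=> v; rewrite zero_lfunE; apply: beta0.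
have := congr1 (fun f : rep_hom q q => f u) hK.
by rewrite comp_lfunE bbar0 linear0 id_lfunE.
Qed.

Lemma qf_lie_object_is_quasi_frobenius : [pchar k] =i pred0 ->
  @is_qf_lie_object (Rep g) q (rep_left_dual q) b bbar ->
  is_quasi_frobenius br beta.
Proof.
move=> char_k qfb; split=> [|v a u u'|u a v v'|u v|u|v beta0|u v w].
- by apply: (tens_hom_is_lie_bracket char_k); case: qfb.
- by rewrite /beta linearP add_lfunE scale_lfunE.
- by rewrite /beta linearP.
- exact: qf_lie_object_skew qfb.
- exact: qf_lie_object_nondegl qfb.
(* Skew-symmetry turns the right kernel into the left one. *)
- apply: (qf_lie_object_nondegl qfb) => u.
  by rewrite (qf_lie_object_skew _ _ qfb) beta0 oppr0.
- exact: qf_lie_object_cocycle qfb.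
Qed.

End QFLieObject.

Theorem proposition3p12 (k : fieldType) (char_k : [pchar k] =i pred0)
    (g : finLieAlgType k) (q : rep g)
    (b : rep_hom (rep_tensor q q) q) (bbar : rep_hom q (rep_dual q)) :
  @is_qf_lie_object (Rep g) q (rep_left_dual q) b bbar ->
  @is_g_quasi_frobenius k g q
    (fun u v : q => b (tens u v))
    (fun u v : q => (bbar u : 'Hom(q, k^o)) v)
    (@rep_act k g q).
Proof.
move=> qfb; split=> [||x u v|x u v].
- exact: qf_lie_object_is_quasi_frobenius char_k qfb.
- exact: rep_actP.
(* The action on a tensor product is itself a Leibniz rule, which [b] transports. *)
- by rewrite -rep_hom_act rep_tensorE linearD.
(* The sign in the dual action makes the two terms cancel. *)
- by rewrite rep_hom_act dual_actE addNr.
Qed.
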